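(* Let $\mathcal{V}$ be a finite vocabulary, let $L\ge 1$ be an integer, and let $q_1,\dots,q_L$ be probability distributions on $\mathcal{V}$ with $q_i(v)\in(0,1)$ for all $i\in\{1,\dots,L\}$ and $v\in\mathcal{V}$. Let $Q(y_{1:L})=\prod_{i=1}^{L} q_i(y_i)$ be the product distribution on $\mathcal{V}^L$. Let $B\ge 1$ be an integer with $B<\sum_{d=1}^{L}|\mathcal{V}|^d$, and let $K=\min(B,|\mathcal{V}|)$. Then the best-first draft-tree construction algorithm (described in the context), run with the top-$K$ tokens at each depth, their probabilities, and node budget $B$, returns a valid draft tree $T$ with $|T|\le B$ that attains the maximum $$\max_{T':\,|T'|\le B,\ T'\text{ valid}}\ \mathbb{E}_{Y_{1:L}\sim Q}\bigl[\alpha_{T'}(Y_{1:L})\bigr].$$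
   Context: A prefix is a tuple $u=(u_1,\dots,u_d)\in\mathcal{V}^d$ with $1\le d\le L$. A draft tree $T$ is a set of prefixes. It is valid if it is prefix-closed: whenever $(u_1,\dots,u_d)\in T$ with $d\ge 2$, also $(u_1,\dots,u_{d-1})\in T$. (The empty prefix, i.e. the root, is not an element of $T$ and does not count toward $|T|$.) For $y_{1:L}=(y_1,\dots,y_L)\in\mathcal{V}^L$ write $y_{1:d}=(y_1,\dots,y_d)$. The acceptance length of $y_{1:L}$ under $T$ is $\alpha_T(y_{1:L})=\max\{d\in\{1,\dots,L\}: y_{1:d}\in T\}$, with $\alpha_T(y_{1:L})=0$ when $y_{1:1}\notin T$. Rank notation. At each depth $i\in\{1,\dots,L\}$ let $v_i^{(1)},v_i^{(2)},\dots,v_i^{(|\mathcal{V}|)}$ be the tokens of $\mathcal{V}$ ordered so that $q_i(v_i^{(1)})\ge q_i(v_i^{(2)})\ge\cdots$, and let $q_i^{(k)}=q_i(v_i^{(k)})$. A rank tuple $\rho=(\rho_1,\dots,\rho_d)$, $1\le d\le L$, $1\le\rho_i\le|\mathcal{V}|$, denotes the prefix $(v_1^{(\rho_1)},\dots,v_d^{(\rho_d)})$, and its score is $\sigma(\rho)=\sum_{i=1}^{d}\log q_i^{(\rho_i)}$. Best-first draft-tree construction algorithm. Input: the tokens $v_i^{(k)}$ and probabilities $q_i^{(k)}$ for $1\le i\le L$, $1\le k\le K$, and the node budget $B$. 1. Initialize a max-heap $H$ (priority queue keyed by score) containing only the rank tuple $(1)$ of length one, with score $\sigma((1))$; initialize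 $T=\varnothing$. 2. While $|T|<B$ and $H\ne\varnothing$: (a) pop (remove) from $H$ a rank tuple $\rho=(\rho_1,\dots,\rho_d)$ with largest score $\sigma(\rho)$; (b) add the prefix $(v_1^{(\rho_1)},\dots,v_d^{(\rho_d)})$ to $T$; (c) if $\rho_d+1\le K$, push into $H$ the tuple $(\rho_1,\dots,\rho_{d-1},\rho_d+1)$ with score $\sigma(\rho)-\log q_d^{(\rho_d)}+\log q_d^{(\rho_d+1)}$; (d) if $d<L$, push into $H$ the tuple $(\rho_1,\dots,\rho_d,1)$ with score $\sigma(\rho)+\log q_{d+1}^{(1)}$. 3. Return $T$. Ties (in the token orderings and among heap entries of equal score) are broken arbitrarily. In the application the $q_i$ are per-position distributions of a draft model conditional on a fixed context $c$ and token $b$; this fixed conditioning is suppressed in the notation. *)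

(* Defs.v *)
From HB Require Import structures.
From Stdlib Require Export Relation_Operators.
From mathcomp Require Export all_boot all_order all_algebra.
From mathcomp Require Export finmap.
From mathcomp Require Export reals exp.

Set Implicit Arguments.
Unset Strict Implicit.
Unset Printing Implicit Defensive.

Import Order.TTheory GRing.Theory Num.Theory.

Local Open Scope fset_scope.
Local Open Scope ring_scope.

(* Conventions.  Depths and ranks are natural numbers counted from 1, so a      *)
(* family indexed by depths 1..L (or ranks 1..#|V|) is a function on [nat] whose *)
(* values outside that range are irrelevant.  A prefix (u_1, ..., u_d) is the    *)
(* sequence [:: u_1; ...; u_d]; a rank tuple is a [seq nat].                     *)

Section DraftTrees.

Variables (V : finType) (L : nat).

Definition draft_tree (T : {fset seq V}) : Prop :=
  forall u, u \in T -> (1 <= size u <= L)%N.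

Definition prefix_closed (T : {fset seq V}) : Prop :=
  forall u, u \in T -> (2 <= size u)%N -> take (size u).-1 u \in T.

Definition valid_draft_tree (T : {fset seq V}) : Prop :=
  draft_tree T /\ prefix_closed T.

Definition acceptance_length (T : {fset seq V}) (y : L.-tuple V) : nat :=
  if take 1%N y \in T then (\max_(1 <= d < L.+1 | take d y \in T) d)%N else 0%N.

Variables (R : realType) (q : nat -> V -> R).

Definition product_distr (y : L.-tuple V) : R :=
  \prod_(i < L) q i.+1 (tnth y i).

Definition expected_acceptance (T : {fset seq V}) : R :=
  \sum_(y : L.-tuple V) product_distr y * (acceptance_length T y)%:R.

End DraftTrees.

(* [v 1, ..., v #|V|] lists every token exactly once, by non-increasing          *)
(* probability; the order of equiprobable tokens is unconstrained.               *)
Definition token_ranking (V : finType) (R : realType)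
    (p : V -> R) (v : nat -> V) : Prop :=
  perm_eq [seq v k | k <- iota 1 #|V|] (enum V) /\
  (forall k l, (1 <= k)%N -> (k <= l)%N -> (l <= #|V|)%N -> p (v l) <= p (v k)).

Section BestFirst.

Variables (V : finType) (R : realType) (L K : nat).

(* [tok i k] and [prob i k] are only read for 1 <= i <= L and 1 <= k <= K. *)
Variables (tok : nat -> nat -> V) (prob : nat -> nat -> R) (B : nat).

Definition rank_prefix (rho : seq nat) : seq V :=
  mkseq (fun j => tok j.+1 (nth 0%N rho j)) (size rho).

Definition score (rho : seq nat) : R :=
  \sum_(0 <= j < size rho) ln (prob j.+1 (nth 0%N rho j)).

(* A heap is a multiset, represented by a list, of rank tuples paired with the   *)
(* score they were pushed with.                                                  *)
Definition heap : Type := seq (seq nat * R).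
Definition state : Type := (heap * {fset seq V})%type.

Definition init_state : state := ([:: ([:: 1%N], score [:: 1%N])], fset0).

Definition maximal_entry (H : heap) (e : seq nat * R) : Prop :=
  e \in H /\ forall e', e' \in H -> e'.2 <= e.2.

Definition sibling_push (rho : seq nat) (s : R) : heap :=
  let d := size rho in
  let r := last 0%N rho in
  if (r + 1 <= K)%N
  then [:: (rcons (take d.-1 rho) (r + 1)%N,
            s - ln (prob d r) + ln (prob d (r + 1)%N))]
  else [::].

Definition child_push (rho : seq nat) (s : R) : heap :=
  let d := size rho in
  if (d < L)%N
  then [:: (rcons rho 1%N, s + ln (prob (d + 1)%N 1%N))]
  else [::].

Definition loop_guard (st : state) : bool :=
  (#|` st.2 | < B)%N && (st.1 != [::]).

(* One loop iteration; any entry of largest score may be popped, so the relation *)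
(* ranges over all ways of breaking ties.                                        *)
Inductive bfs_step : state -> state -> Prop :=
| BfsStep (H : heap) (T : {fset seq V}) (rho : seq nat) (s : R) :
    loop_guard (H, T) -> maximal_entry H (rho, s) ->
    bfs_step (H, T)
      (rem (rho, s) H ++ sibling_push rho s ++ child_push rho s,
       rank_prefix rho |` T).

Definition bfs_terminates : Prop :=
  Acc (fun st' st => bfs_step st st') init_state.

Definition bfs_returns (T : {fset seq V}) : Prop :=
  exists H : heap, clos_refl_trans state bfs_step init_state (H, T) /\
    ~~ loop_guard (H, T).

End BestFirst.

(* Main.v *)
(* For a valid tree T the acceptance length counts the prefixes of Y lying in T,  *)
(* so E[alpha_T] is the sum over u in T of the marginal weight prod_i q_i(u_i),   *)
(* whose logarithm is the score.  A tree is thus optimal as soon as it is full    *)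
(* and each of its prefixes weighs at least as much as each prefix outside it.    *)
(* Rank tuples form a tree along which scores decrease, each tuple being pushed   *)
(* only by its parent; the heap is the frontier of the popped tuples, so every    *)
(* tuple not yet popped scores at most some heap entry, hence at most every       *)
(* popped tuple.  When K = B < |V|, a tuple with some rank above B is no better   *)
(* than the B tuples obtained by clamping its ranks to B and letting that rank    *)
(* run over 1..B; these, together with a popped tuple of smaller score, would     *)
(* not fit in the budget.                                                         *)

Require Import Defs.
From mathcomp Require Import all_boot all_order all_algebra.
From mathcomp Require Import finmap.
From mathcomp Require Import reals exp.

Set Implicit Arguments.
Unset Strict Implicit.
Unset Printing Implicit Defensive.

Import Order.TTheory GRing.Theory Num.Theory.

Local Open Scope fset_scope.
Local Open Scope ring_scope.

(** For a valid tree the accepted depths form an initial segment, so the objective becomes a sum of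
    fixed positive node weights ([expected_acceptance_weight]), each the exponential of a score. By
    the exchange argument [ler_sum_fset_dominated], a tree with [B] nodes is optimal once no outside
    prefix outweighs a node of it.

    The search achieves this because scores never increase from [parent] to child. The heap is the
    frontier of the popped set ([search_invariant_step]), hence bounds every unpopped tuple
    ([heap_dominates]) and is bounded by every popped one. Ignoring ranks above [K] is harmless by
    counting: [unpopped_score_le] compares such tuples with the popped ones, and [final_state] shows
    that the search stops only with a full tree or with all prefixes. Termination holds since every
    iteration adds a new prefix. *)

(** * Comparison of finite sums *)

Lemma ler_sum_size (R : numDomainType) (I : eqType) (w : I -> R) (s t : seq I) :
    (size s <= size t)%N ->
    {in s & t, forall a b, w a <= w b} -> {in t, forall b, 0 <= w b} ->
  \sum_(a <- s) w a <= \sum_(b <- t) w b.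
Proof.
elim: s t => [|a s IHs] [|b t] //= lest ab t0.
  by rewrite big_nil big_seq; apply: sumr_ge0 => i /t0.
rewrite !big_cons lerD ?ab ?mem_head //; apply: IHs => //.
  by move=> x y xs yt; apply: ab; rewrite in_cons ?xs ?yt orbT.
by move=> y yt; apply: t0; rewrite in_cons yt orbT.
Qed.

(** The elements common to [A] and [B] cancel; those left in [A] are no more numerous than those
    left in [B], and each is dominated by all of them. *)
Lemma ler_sum_fset_dominated (R : numDomainType) (I : choiceType) (w : I -> R)
    (A B : {fset I}) :
    (#|` A| <= #|` B|)%N -> {in B, forall b, 0 <= w b} ->
    (forall a b, a \in A -> a \notin B -> b \in B -> w a <= w b) ->
  \sum_(a <- A) w a <= \sum_(b <- B) w b.
Proof.
move=> leAB w0 wAB.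
rewrite (bigID (mem B)) [leRHS](bigID (mem A)) /= -!(big_filter _ (fun i => i \in _)).
rewrite -!(big_filter _ (fun i => i \notin _)).
have eqAB : perm_eq [seq x <- A | x \in B] [seq x <- B | x \in A].
  by apply: uniq_perm; rewrite ?filter_uniq // => x; rewrite !mem_filter andbC.
rewrite (perm_big _ eqAB) lerD2l; apply: ler_sum_size.
- rewrite !size_filter -(leq_add2l (count (mem B) A)) count_predC.
  by move/perm_size: eqAB; rewrite !size_filter => ->; rewrite count_predC.
- by move=> a b; rewrite !mem_filter => /andP[aB aA] /andP[_ bB]; apply: wAB.
- by move=> b; rewrite mem_filter => /andP[_ /w0].
Qed.

(** The depths satisfying [p] form an interval starting at 1, whose largest element is its
    cardinality. *)
Lemma bigmax_initial_segment (n : nat) (p : pred nat) :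
    (forall d, (1 <= d)%N -> p d.+1 -> p d) ->
  (\max_(1 <= d < n.+1 | p d) d = \sum_(1 <= d < n.+1) p d)%N.
Proof.
move=> pS; elim: n => [|n IHn]; first by rewrite !big_geq.
rewrite big_mkcond big_nat_recr //= -big_mkcond IHn [RHS]big_nat_recr //=.
have [pn1|_] := boolP (p n.+1); last by rewrite maxn0 addn0.
have pd d : (1 <= d < n.+1)%N -> p d.
  elim: n pn1 {IHn} => [|n IHn] pn; first by case: d.
  rewrite ltnS [(d <= _)%N]leq_eqVlt => /andP[d1 /predU1P[->|dn]]; first exact: pS.
  by apply: IHn; [exact: pS | rewrite d1].
rewrite (eq_big_nat _ _ (F2 := fun=> 1%N)) => [|d /pd -> //].
by rewrite sum_nat_const_nat muln1 subn1 addn1; apply/maxn_idPr.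
Qed.

(** * Expected acceptance length as a sum of marginal weights *)

Section Acceptance.
Variables (R : realType) (V : finType) (L : nat) (q : nat -> V -> R).

(** For [u] of length at most [L], the probability that a sample starts with [u]. Using [tnth]
    avoids a default token. *)
Definition prefix_weight (u : seq V) : R :=
  \prod_(i < size u) q i.+1 (tnth (in_tuple u) i).

(** Prefix closure turns the largest accepted depth into the number of accepted depths, and each of
    these matches exactly one node. *)
Lemma acceptance_length_count (T : {fset seq V}) (y : L.-tuple V) :
    valid_draft_tree L T ->
  acceptance_length T y = (\sum_(u <- T) (take (size u) y == u))%N.
Proof.
move=> [dT pT].
have pS d : (1 <= d)%N -> take d.+1 y \in T -> take d y \in T.
  move=> d1 dyT; have /dT := dyT; rewrite size_take_min size_tuple => sz.
  (* From [L] on, truncation changes nothing and both prefixes are [y]. *)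
  have [dL|Ld] := ltnP d L; last by move: dyT; rewrite !take_oversize ?size_tuple // ltnW.
  have := pT _ dyT; rewrite size_takel ?size_tuple //= take_takel //; exact.
have -> : acceptance_length T y = (\sum_(1 <= d < L.+1) (take d y \in T))%N.
  rewrite /acceptance_length -(bigmax_initial_segment L pS); case: ifPn => // n1.
  rewrite big_nat_cond big_pred0 // => d; apply/negP => /andP[/andP[d1 _]].
  by elim: d d1 => // -[|d] IHd _; [apply/negP | move/(pS d.+1 isT); apply: IHd].
under eq_bigr => d _.
  have -> : (take d y \in T : nat) = (\sum_(u <- T) (take d y == u))%N.
    have -> : (take d y \in T : nat) = count_mem (take d y) (enum_fset T).
      by rewrite count_uniq_mem ?fset_uniq.
    rewrite -sum1_count big_mkcond; apply: eq_bigr => u _ /=.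
    by rewrite eq_sym; case: (_ == _).
  over.
rewrite exchange_big [LHS]big_seq [RHS]big_seq; apply: eq_bigr => u /dT /andP[u1 uL].
(* Only [d = size u] contributes, and the depth bound places it in the range. *)
rewrite (big_cat_nat _ (n := size u)) //=; last exact: leqW.
rewrite (big_ltn (m := size u)) // [X in (X + _)%N]big_nat [X in (_ + (_ + X))%N]big_nat.
have neq d : (d <= L)%N -> d != size u -> take d y == u = false.
  by move=> dL; apply: contra_neqF => /eqP <-; rewrite size_takel ?size_tuple.
rewrite !big1 ?add0n ?addn0 // => d /andP[lo hi].
  by rewrite neq // gtn_eqF.
by rewrite neq // ?ltn_eqF // (leq_trans (ltnW hi)).
Qed.

Hypothesis hq1 : forall i, (1 <= i <= L)%N -> \sum_(x : V) q i x = 1.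

(** The indicator that [y] starts with [u] factors over positions, so the sum over tuples is a
    product of one-position sums; those past the end of [u] equal 1. *)
Lemma product_distr_marginal (u : seq V) : (size u <= L)%N ->
  \sum_(y : L.-tuple V) product_distr q y * (take (size u) y == u)%:R
  = prefix_weight u.
Proof.
move=> uL.
(* The implication makes the indicator 1 past the end of [u]; [x] is a default that is harmless
   under this guard. *)
pose F (i : 'I_L) x := q i.+1 x * ((i < size u)%N ==> (nth x u i == x))%:R.
transitivity (\sum_(y : L.-tuple V) \prod_(i < L) F i (tnth y i)).
  apply: eq_bigr => y _; rewrite big_split; congr (_ * _).
  rewrite -natr_prod; congr (_%:R).
  have -> : (take (size u) y == u) =
      [forall i : 'I_L, (i < size u)%N ==> (nth (tnth y i) u i == tnth y i)].
    apply/eqP/'forall_implyP => [yu i iu|yu].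
      by rewrite -{1}yu nth_take // -tnth_nth.
    have szt : size (take (size u) y) = size u by rewrite size_takel ?size_tuple.
    case: u uL yu szt {F} => [|x0 u] uL yu szt; first by rewrite take0.
    apply: (@eq_from_nth _ x0) => // i; rewrite szt => iu.
    have iL := leq_trans iu uL.
    have /eqP := yu (Ordinal iL) iu.
    by rewrite nth_take // (tnth_nth x0) /= (set_nth_default x0).
  case: forallP => [yu|/forallP]; first by rewrite big1 // => i _; rewrite yu.
  by rewrite negb_forall => /existsP[i /negPf yi]; rewrite (bigD1 i) //= yi.
(* Expanding a product of sums runs over finite functions rather than tuples. *)
rewrite (reindex (@tuple_of_finfun V L)); last first.
  by exists finfun_of_tuple => f _; [exact: tuple_of_finfunK | exact: finfun_of_tupleK].
under eq_bigr => f _ do under eq_bigr => i _ do rewrite tnth_mktuple.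
rewrite -(bigA_distr_bigA F).
have F1 (i : 'I_L) : (size u <= i)%N -> \sum_x F i x = 1.
  move=> ui; rewrite -(hq1 (i := i.+1)) ?ltn_ord //; apply: eq_bigr => x _.
  by rewrite /F ltnNge ui mulr1.
have Fu (i : 'I_L) x0 : (i < size u)%N -> \sum_x F i x = q i.+1 (nth x0 u i).
  move=> iu; rewrite (bigD1 (nth x0 u i)) //= big1 ?addr0 /F => [|x].
    by rewrite iu /= (set_nth_default x0) // eqxx mulr1.
  by rewrite iu /= (set_nth_default x0) // eq_sym => /negPf ->; rewrite mulr0.
rewrite /prefix_weight; case: u uL @F F1 Fu => [|x0 u] uL F F1 Fu.
  by rewrite big_ord0 big1 // => i _; rewrite F1.
under [RHS]eq_bigr => i _ do rewrite (tnth_nth x0) /=.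
rewrite (big_ord_widen L (fun i => q i.+1 (nth x0 (x0 :: u) i))) //.
rewrite [RHS]big_mkcond; apply: eq_bigr => i _.
by case: ltnP => ui; [rewrite (Fu _ x0) | rewrite F1].
Qed.

Lemma expected_acceptance_weight (T : {fset seq V}) : valid_draft_tree L T ->
  expected_acceptance L q T = \sum_(u <- T) prefix_weight u.
Proof.
move=> vT; rewrite /expected_acceptance.
under eq_bigr => y _ do rewrite (acceptance_length_count y vT) natr_sum big_distrr.
rewrite exchange_big [LHS]big_seq [RHS]big_seq; apply: eq_bigr => u /vT.1 /andP[_ uL].
exact: product_distr_marginal.
Qed.

End Acceptance.

(** * The tree of rank tuples *)

Lemma take_size_rcons (T : Type) (s : seq T) x : take (size s) (rcons s x) = s.
Proof. by rewrite -cats1 take_size_cat. Qed.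

Section RankTuples.
Variables L K : nat.
Implicit Types rho tau : seq nat.

(** Used both with the rank cap of the search and with the vocabulary size, where it describes all
    prefixes. *)
Definition rank_box rho : bool :=
  (1 <= size rho <= L)%N && all (fun r => 1 <= r <= K)%N rho.

(* The node whose expansion pushes [rho]; [:: 1] has the virtual root [::] as   *)
(* its parent.                                                                   *)
Definition parent rho : seq nat :=
  let tau := take (size rho).-1 rho in let r := last 0%N rho in
  if (r <= 1)%N then tau else rcons tau r.-1.

Lemma parent_rcons tau r :
  parent (rcons tau r) = if (r <= 1)%N then tau else rcons tau r.-1.
Proof. by rewrite /parent last_rcons size_rcons take_size_rcons. Qed.

Lemma rank_box_rcons tau r :
  rank_box (rcons tau r) = [&& (size tau < L)%N, (1 <= r <= K)%N &
                               (tau == [::]) || rank_box tau].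
Proof.
rewrite /rank_box size_rcons all_rcons /=; case: tau => [|x tau] /=.
  by rewrite andbT.
by case: ltnP => //= sz; rewrite (ltnW sz).
Qed.

Lemma rank_box_neq0 rho : rank_box rho -> rho != [::].
Proof. by case: rho. Qed.

Lemma rank_box_parent rho : rank_box rho ->
  parent rho = [::] \/ rank_box (parent rho).
Proof.
case/lastP: rho => // tau r; rewrite rank_box_rcons parent_rcons.
case/and3P => sz /andP[r1 rK] /predU1P tau_box.
case: leqP => r2; first by case: tau_box; auto.
right; rewrite rank_box_rcons sz -ltnS prednK // r2 (leq_trans (leq_pred _)) //=.
exact/predU1P.
Qed.

(** Dropping the last entry shortens the tuple and decrementing it lowers the rank sum; this makes
    [parent] well-founded. *)
Lemma parent_measure rho : rho != [::] ->
  (size (parent rho) + sumn (parent rho) < size rho + sumn rho)%N.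
Proof.
case/lastP: rho => // tau r _; rewrite parent_rcons.
case: (leqP r 1) => r1; rewrite !size_rcons !sumn_rcons.
  by rewrite addSn ltnS leq_add2l leq_addr.
by rewrite !ltn_add2l prednK // ltnW.
Qed.

Lemma parent_neq rho : rho != [::] -> parent rho != rho.
Proof. by move=> /parent_measure; apply: contraTneq => ->; rewrite ltnn. Qed.

Lemma parent_ind (Q : seq nat -> Prop) :
  (forall rho, (rho != [::] -> Q (parent rho)) -> Q rho) -> forall rho, Q rho.
Proof.
move=> step rho; have [n] := ubnP (size rho + sumn rho).
elim: n rho => // n IHn rho; rewrite ltnS => le_n; apply: step => rho0.
by apply: IHn; exact: leq_trans (parent_measure rho0) le_n.
Qed.

(** Iterating [parent] brings the last rank down to 1 and then drops it, so closure under [parent]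
    yields prefix closure. *)
Lemma rank_box_take1 (P : {fset seq nat}) rho :
    {in P, forall rho, rank_box rho} ->
    {in P, forall rho, parent rho \in [::] |` P} ->
    rho \in P -> (2 <= size rho)%N -> take (size rho).-1 rho \in P.
Proof.
move=> boxP parP; case/lastP: rho => // tau r.
rewrite size_rcons ltnS take_size_rcons.
elim: r => [|r IHr] trP sz.
  by have := boxP _ trP; rewrite rank_box_rcons andbF.
have := parP _ trP; rewrite parent_rcons /= !inE; case: ifP => _.
  by case/predU1P => // tau0; rewrite tau0 in sz.
by case/predU1P => [/(congr1 size)|/IHr->//]; rewrite size_rcons.
Qed.

End RankTuples.

(** * Additive scores *)

Section Score.
Variables (R : realType) (prob : nat -> nat -> R).
Implicit Types rho tau : seq nat.

Lemma score_rcons tau r :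
  score prob (rcons tau r) = score prob tau + ln (prob (size tau).+1 r).
Proof.
rewrite /score size_rcons big_nat_recr //= nth_rcons ltnn eqxx; congr (_ + _).
by rewrite !big_nat; apply: eq_bigr => j /andP[_ jt]; rewrite nth_rcons jt.
Qed.

Lemma ler_score rho tau : size rho = size tau ->
    (forall j, (j < size tau)%N ->
       ln (prob j.+1 (nth 0%N rho j)) <= ln (prob j.+1 (nth 0%N tau j))) ->
  score prob rho <= score prob tau.
Proof.
by move=> sz le_rt; rewrite /score sz !big_nat; apply: ler_sum => j /le_rt.
Qed.

End Score.

(** * The search and its invariant; [N] stands for the vocabulary size *)

Section Search.
Variables (V : finType) (R : realType) (L K N : nat).
Variables (tok : nat -> nat -> V) (prob : nat -> nat -> R) (B : nat).
Hypothesis (L_gt0 : (0 < L)%N) (K_gt0 : (0 < K)%N) (K_min : K = minn B N).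
Hypothesis tok_inj : forall i k l, (1 <= i <= L)%N -> (1 <= k <= K)%N ->
  (1 <= l <= K)%N -> tok i k = tok i l -> k = l.
Hypothesis ln_prob_le0 : forall i k, (1 <= i <= L)%N -> (1 <= k <= K)%N ->
  ln (prob i k) <= 0.
Hypothesis ln_prob_noninc : forall i k l, (1 <= i <= L)%N -> (1 <= k)%N ->
  (k <= l <= N)%N -> ln (prob i l) <= ln (prob i k).

Local Notation box := (rank_box L K).
Local Notation score := (score prob).
Local Notation pushes rho s :=
  (sibling_push K prob rho s ++ child_push L prob rho s).
Implicit Types (rho tau : seq nat) (H : heap R) (P : {fset seq nat}).

Lemma score_parent rho : box rho -> parent rho != [::] ->
  score rho <= score (parent rho).
Proof.
case/lastP: rho => // tau r; rewrite rank_box_rcons parent_rcons.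
case/and3P => sz rK _; case: leqP => r1 _; rewrite !score_rcons.
  by rewrite gerDl ln_prob_le0.
case/andP: rK => r0 rK.
rewrite lerD2l; apply: ln_prob_noninc => //; first by rewrite -ltnS prednK.
by rewrite leq_pred (leq_trans rK) // K_min geq_minr.
Qed.

(** Together with [parent_pushed] and [uniq_pushes]: an expansion pushes exactly the children in the
    box, once each, and the incremental score update is exact. *)
Lemma mem_pushes rho tau s t : box rho -> s = score rho ->
    (tau, t) \in pushes rho s ->
  [/\ t = score tau, box tau & parent tau = rho].
Proof.
case/lastP: rho => // w r box_wr s_def; rewrite mem_cat.
have := box_wr; rewrite rank_box_rcons => /and3P[sz /andP[r0 rK] w_box].
rewrite /sibling_push /child_push size_rcons last_rcons /= take_size_rcons.
case/orP; case: ifP => // ok; rewrite inE => /eqP[-> ->].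
  have r2 : (r + 1 <= 1)%N = false by rewrite addn1 ltnS leqNgt r0.
  rewrite rank_box_rcons parent_rcons sz w_box r2 ok addn1 /=.
  by rewrite s_def !score_rcons [_ + ln _ - _]addrK.
by rewrite rank_box_rcons parent_rcons box_wr size_rcons ok K_gt0 orbT
  score_rcons s_def size_rcons addn1.
Qed.

Lemma parent_pushed rho s tau : box rho -> box tau -> parent tau = rho ->
  tau \in [seq e.1 | e <- pushes rho s].
Proof.
case/lastP: tau => // w r box_rho; rewrite rank_box_rcons parent_rcons map_cat mem_cat.
case/and3P => sz /andP[r0 rK] w_box; case: leqP => r1 rho_def.
  have -> : r = 1%N by apply/eqP; rewrite eqn_leq r1.
  by rewrite /child_push -rho_def sz mem_seq1 eqxx orbT.
rewrite /sibling_push -rho_def size_rcons last_rcons /= take_size_rcons.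
by rewrite addn1 prednK // rK mem_seq1 eqxx.
Qed.

Lemma uniq_pushes rho s : box rho -> uniq [seq e.1 | e <- pushes rho s].
Proof.
case/lastP: rho => // w r _.
rewrite /sibling_push /child_push size_rcons last_rcons /= take_size_rcons.
case: ifP => _; case: ifP => _ //=; rewrite inE andbT.
by apply/eqP => /(congr1 size)/eqP; rewrite !size_rcons ltn_eqF.
Qed.

(* [P] is the set of rank tuples popped so far. *)
Record search_invariant H P : Prop := SearchInvariant {
  popped_box : {in P, forall rho, box rho};
  popped_parent : {in P, forall rho, parent rho \in [::] |` P};
  heap_uniq : uniq [seq e.1 | e <- H];
  heap_entry : forall rho s, (rho, s) \in H ->
    [/\ s = score rho, box rho, rho \notin P & parent rho \in [::] |` P];
  heap_frontier : forall rho, box rho -> rho \notin P ->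
    parent rho \in [::] |` P -> rho \in [seq e.1 | e <- H];
  popped_best : forall rho e, rho \in P -> e \in H -> e.2 <= score rho }.

Lemma search_invariant_init :
  search_invariant [:: ([:: 1%N], score [:: 1%N])] fset0.
Proof.
split=> //.
- move=> rho s; rewrite !inE => /eqP[-> ->]; split=> //.
  by rewrite -[[:: 1%N]]/(rcons [::] 1%N) rank_box_rcons L_gt0 K_gt0.
- case/lastP => // tau r; rewrite rank_box_rcons parent_rcons inE.
  case/and3P => _ /andP[r0 _] _ _; rewrite in_fset1U in_fset0 orbF.
  case: leqP => r1 /eqP; last by move/(congr1 size); rewrite size_rcons.
  by move=> ->; rewrite inE /=; rewrite (_ : r = 1%N) //; apply/eqP; rewrite eqn_leq r1.
Qed.

(** Popping [rho] replaces it in the frontier by its children. It has maximal score, so the entries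
    left behind, and its children, score no more than it. *)
Lemma search_invariant_step H P rho s :
    search_invariant H P -> maximal_entry H (rho, s) ->
  search_invariant (rem (rho, s) H ++ pushes rho s) (rho |` P).
Proof.
move=> [boxP parP uH entH frontH bestP] [rsH maxH].
have [s_def box_rho rhoP par_rho] := entH _ _ rsH.
have rho0 := rank_box_neq0 box_rho.
have uniqH := map_uniq uH.
have pushE tau t := @mem_pushes rho tau s t box_rho s_def.
(* As [rho] was unpopped, none of its children was in the heap or popped before. *)
have parF tau : parent tau = rho -> parent tau \notin [::] |` P.
  by move=> ->; rewrite !inE negb_or rho0.
have subP tau : tau \in [::] |` P -> tau \in [::] |` (rho |` P).
  by rewrite !inE => /orP[->//|->]; rewrite !orbT.
(* Heap keys are distinct, so one removal eliminates [rho] entirely. *)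
have remE tau t : (tau, t) \in rem (rho, s) H -> tau != rho.
  move=> tH; apply/eqP => tau_def; have [t_def _ _ _] := entH _ _ (mem_rem tH).
  by move: tH; rewrite t_def tau_def -s_def mem_rem_uniq // !inE eqxx.
split.
- by move=> tau; rewrite !inE => /predU1P[->//|/boxP].
- by move=> tau; rewrite in_fset1U => /predU1P[->|/parP] //; exact: subP.
- rewrite map_cat cat_uniq uniq_pushes // andbT.
  rewrite (subseq_uniq (map_subseq _ (rem_subseq _ _))) //=.
  apply/hasPn => _ /mapP[[tau t] /pushE[_ _ ptau] ->] /=.
  apply/mapP => -[[tau' t'] /mem_rem/entH[_ _ _ par'] /= tau_def].
  by have := parF _ ptau; rewrite tau_def par'.
- move=> tau t; rewrite mem_cat => /orP[tH|/pushE[-> -> ptau]].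
    have [-> -> tauP ptau] := entH _ _ (mem_rem tH).
    by rewrite in_fset1U negb_or tauP (remE _ _ tH) subP.
  split=> //; last by rewrite ptau !inE eqxx orbT.
  rewrite in_fset1U negb_or -{1}ptau eq_sym parent_neq /=; last first.
    by apply: contra_neq rho0 => tau0; rewrite -ptau tau0.
  by apply: contraNN (parF _ ptau) => /parP.
- move=> tau box_tau; rewrite in_fset1U negb_or => /andP[neq tauP] ptau.
  rewrite map_cat mem_cat.
  have [/parent_pushed->|nptau] := eqVneq (parent tau) rho; rewrite ?orbT //.
  have /mapP[[tau' t] tH /= tau_def] : tau \in [seq e.1 | e <- H].
    apply: frontH => //; move: ptau; rewrite !inE (negPf nptau); exact.
  apply/orP; left; apply/mapP; exists (tau', t) => //; apply: rem_mem => //.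
  by rewrite xpair_eqE -tau_def (negPf neq).
- have le_push e : e \in pushes rho s -> e.2 <= score rho.
    case: e => tau t /pushE[-> box_tau ptau] /=.
    by rewrite -ptau score_parent ?ptau.
  move=> tau e; rewrite in_fset1U mem_cat.
  move=> /predU1P[->|tauP] /orP[/mem_rem eH|/le_push le_e] //.
  + by rewrite -s_def; exact: maxH.
  + exact: bestP.
  + by apply: le_trans le_e _; rewrite -s_def; exact: (bestP _ (rho, s)).
Qed.

(** Climbing through parents never lowers the score and ends at an unpopped tuple whose parent is
    popped or the virtual root; that tuple is in the heap. *)
Lemma heap_dominates H P rho : search_invariant H P -> box rho ->
  rho \notin P -> exists2 e, e \in H & score rho <= e.2.
Proof.
move=> inv; elim/parent_ind: rho => rho IHrho box_rho rhoP.
have [par|] := boolP (parent rho \in [::] |` P).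
  have /mapP[[tau t] tH /= ->] := heap_frontier inv box_rho rhoP par.
  by exists (tau, t) => //; have [-> _ _ _] := heap_entry inv tH.
rewrite !inE negb_or => /andP[par0 parP].
case: (rank_box_parent box_rho) => [par_nil|box_par]; first by rewrite par_nil in par0.
have [e eH le_e] := IHrho (rank_box_neq0 box_rho) box_par parP.
by exists e => //; apply: le_trans le_e; exact: score_parent.
Qed.

(** * Program states, termination and validity *)

Lemma size_rank_prefix rho : size (rank_prefix tok rho) = size rho.
Proof. exact: size_mkseq. Qed.

Lemma rank_prefix_inj : {in box &, injective (rank_prefix tok)}.
Proof.
move=> rho tau /andP[/andP[_ rL] /allP rK] /andP[_ /allP tK] eq_rt.
have sz : size rho = size tau by rewrite -!size_rank_prefix eq_rt.
apply: (@eq_from_nth _ 0%N) => // j jr; have jt : (j < size tau)%N by rewrite -sz.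
apply: (@tok_inj j.+1).
- by rewrite (leq_trans jr).
- by apply: rK; exact: mem_nth.
- by apply: tK; exact: mem_nth.
have := congr1 (fun u => nth (tok 0 0) u j) eq_rt.
by rewrite !nth_mkseq.
Qed.

(** [P] is a ghost component: the tree stores tokens only, while the invariant speaks of popped rank
    tuples. *)
Definition state_invariant (st : state V R) (P : {fset seq nat}) : Prop :=
  [/\ search_invariant st.1 P, st.2 = [fset rank_prefix tok rho | rho in P]
    & (#|` st.2 | <= B)%N].

Lemma card_state st P : state_invariant st P -> #|` st.2 | = #|` P |.
Proof.
case=> inv -> _; apply/eqP/card_in_imfsetP => rho tau.
move=> /(popped_box inv) ? /(popped_box inv) ?; exact: rank_prefix_inj.
Qed.

Lemma state_invariant_init : state_invariant (init_state V prob) fset0.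
Proof. by split; [exact: search_invariant_init | rewrite imfset0 | rewrite cardfs0]. Qed.

(** The popped tuple is new and [rank_prefix] is injective on the box, so the tree gains exactly one
    prefix. *)
Lemma state_invariant_step st st' P : state_invariant st P ->
    bfs_step L K tok prob B st st' ->
  (exists P', state_invariant st' P') /\ #|` st'.2 | = #|` st.2 |.+1.
Proof.
move=> invst stst'; case: stst' invst => H T rho s /andP[/= TB _] maxrs [/= inv T_def _].
have [_ box_rho rhoP _] := heap_entry inv maxrs.1.
have card' : #|` rank_prefix tok rho |` T | = #|` T |.+1.
  rewrite cardfsU1 -add1n; congr (_ + _)%N; apply/eqP; rewrite eqb1 T_def.
  apply/imfsetP => -[tau /= tauP eq_prefix]; have rho_def : rho = tau.
    by apply: rank_prefix_inj => //; exact: (popped_box inv tauP).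
  by rewrite rho_def tauP in rhoP.
split=> //; exists (rho |` P); split=> /=.
- exact: search_invariant_step.
- by rewrite imfsetU1 T_def.
- by rewrite card'.
Qed.

Lemma maximal_entry_exists H : H != [::] -> exists e, maximal_entry H e.
Proof.
elim: H => // e [|e' H] IHH _.
  by exists e; split=> [|x]; rewrite inE // => /eqP ->.
have [//|m [mH mmax]] := IHH.
have [le_em|/ltW le_me] := leP e.2 m.2.
  exists m; split; first by rewrite inE mH orbT.
  by move=> x; rewrite inE => /predU1P[->//|/mmax].
exists e; split; first exact: mem_head.
by move=> x; rewrite inE => /predU1P[->//|/mmax/le_trans]; apply.
Qed.

Lemma bfs_terminates_returns :
  bfs_terminates L K tok prob B /\ exists T, bfs_returns L K tok prob B T.
Proof.
suff main n st P : state_invariant st P -> (B - #|` st.2 | <= n)%N ->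
    Acc (fun st' st => bfs_step L K tok prob B st st') st /\
    exists st', clos_refl_trans _ (bfs_step L K tok prob B) st st' /\
                ~~ loop_guard B st'.
  have [] := main _ _ _ state_invariant_init (leqnn _).
  by move=> ? [[H T] ?]; split=> //; exists T, H.
elim: n st P => [|n IHn] st P inv le_n.
  have full : ~~ loop_guard B st.
    by rewrite negb_and -leqNgt -subn_eq0 -leqn0 le_n.
  split; last by exists st; split=> //; exact: rt_refl.
  by constructor=> st' stst'; case: stst' full {inv le_n} => ? ? ? ? ->.
have next st' : bfs_step L K tok prob B st st' ->
    Acc (fun st' st => bfs_step L K tok prob B st st') st' /\
    exists st'', clos_refl_trans _ (bfs_step L K tok prob B) st' st'' /\
                 ~~ loop_guard B st''.
  move=> stst'; have [[P' inv'] card'] := state_invariant_step inv stst'.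
  by apply: IHn inv' _; rewrite card' subnS -ltnS; case: (B - _)%N le_n.
split; first by constructor=> st' /next[].
have [guard|] := boolP (loop_guard B st); last by exists st; split=> //; exact: rt_refl.
case: st guard {inv le_n} next => H T guard next.
have /andP[_ /maximal_entry_exists[[rho s] max_rs]] := guard.
have stst' := BfsStep L K tok prob guard max_rs.
have [_ [st'' [reach done'']]] := next _ stst'.
by exists st''; split=> //; apply: rt_trans reach; exact: rt_step.
Qed.

Lemma reachable_state_invariant st :
  clos_refl_trans _ (bfs_step L K tok prob B) (init_state V prob) st ->
  exists P, state_invariant st P.
Proof.
move=> reach; have : exists P, state_invariant (init_state V prob) P.
  by exists fset0; exact: state_invariant_init.
elim: reach => [st1 st2 step12 [P inv]|//|st1 st2 st3 _ IH12 _ IH23 /IH12/IH23//].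
by have [] := state_invariant_step inv step12.
Qed.

Lemma rank_prefix_valid H P :
  search_invariant H P -> valid_draft_tree L [fset rank_prefix tok rho | rho in P].
Proof.
move=> inv; split=> _ /imfsetP[/= rho rhoP ->]; rewrite size_rank_prefix.
  by have /andP[] := popped_box inv rhoP.
move=> sz; apply/imfsetP; exists (take (size rho).-1 rho) => /=.
  exact: rank_box_take1 (popped_box inv) (popped_parent inv) rhoP sz.
rewrite /rank_prefix /mkseq -map_take take_iota size_takel ?leq_pred //.
rewrite (minn_idPl (leq_pred _)); apply/eq_in_map => j.
by rewrite mem_iota /= add0n => jr; rewrite nth_take.
Qed.

(** Inside the box a heap entry lies between the two scores. Outside it, an unpopped tuple beating
    [tau] would force more than [B] popped tuples. *)
Lemma unpopped_score_le st P rho tau : state_invariant st P ->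
    rank_box L N rho -> rho \notin P -> tau \in P ->
  score rho <= score tau.
Proof.
move=> invst box_rho rhoP tauP; have [inv _ TB] := invst.
have best rho' : box rho' -> rho' \notin P -> score rho' <= score tau.
  move=> box' /(heap_dominates inv box')[e eH /le_trans]; apply.
  exact: (popped_best inv).
have [/best|nbox] := boolP (box rho); first exact.
have /andP[rhoL /allP rhoN] := box_rho.
have [i ir Ki] : exists2 i, (i < size rho)%N & (K < nth 0 rho i)%N.
  move: nbox; rewrite negb_and rhoL /= => /allPn[r r_rho].
  have /andP[-> _] := rhoN _ r_rho; rewrite -ltnNge => Kr.
  by exists (index r rho); rewrite ?index_mem ?nth_index.
have KB : K = B.
  have /andP[_ iN] := rhoN _ (mem_nth 0%N ir).
  by have := leq_trans Ki iN; rewrite K_min gtn_min ltnn orbF => /ltnW/minn_idPl.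
rewrite leNgt; apply/negP => lt_tau.
(* Clamping never lowers the score, and the free rank at [i] gives [K] distinct tuples in the box,
   each beating [tau] and hence popped. *)
pose clamp k := mkseq (fun j => if j == i then k else minn (nth 0 rho j) K)%N (size rho).
have clampP k : (1 <= k <= K)%N -> clamp k \in P /\ clamp k != tau.
  move=> /andP[k1 kK].
  have le_clamp : score rho <= score (clamp k).
    apply: ler_score; rewrite size_mkseq // => j jr; rewrite nth_mkseq //.
    have /andP[j1 jN] := rhoN _ (mem_nth 0%N jr).
    apply: ln_prob_noninc.
    - by case/andP: rhoL => _; exact: leq_trans.
    - by case: ifP => // _; rewrite leq_min j1 K_gt0.
    - rewrite jN andbT; case: eqP => [->|_]; last exact: geq_minl.
      exact: leq_trans kK (ltnW Ki).
  split; last by apply: contraTneq lt_tau => <-; rewrite -leNgt.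
  apply/negPn/negP => clampNP.
  move: lt_tau; rewrite ltNge => /negP; apply; apply: le_trans le_clamp _.
  apply: best clampNP.
  rewrite /rank_box size_mkseq rhoL /=; apply/allP => r /mapP[j].
  rewrite mem_iota /= add0n => jr ->; case: ifP => _; first by rewrite k1.
  have /andP[j1 _] := rhoN _ (mem_nth 0%N jr).
  by rewrite leq_min j1 K_gt0 geq_minr.
(* With [tau] itself this makes [B + 1] popped tuples. *)
have : (size (tau :: [seq clamp k | k <- iota 1 K]) <= size P)%N.
  apply: uniq_leq_size => /= [|w /predU1P[->//|/mapP[k]]].
    apply/andP; split.
      apply/mapP => -[k]; rewrite mem_iota add1n ltnS => /clampP[_ /eqP neq].
      by move/esym/neq.
    rewrite map_inj_uniq ?iota_uniq // => k l /(congr1 (fun s => nth 0%N s i)).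
    by rewrite !nth_mkseq // eqxx.
  by rewrite mem_iota add1n ltnS => /clampP[? _] ->.
by rewrite /= size_map size_iota KB -(card_state invst) ltnNge TB.
Qed.

(** An empty heap means that the whole box is popped. This is every tuple if [N <= B]; otherwise
    [K = B] and the tuples of length one alone fill the budget. *)
Lemma final_state st P : state_invariant st P -> ~~ loop_guard B st ->
  #|` st.2 | = B \/ forall rho, rank_box L N rho -> rho \in P.
Proof.
move=> invst; have [inv _ TB] := invst.
rewrite negb_and -leqNgt negbK => /orP[BT|/eqP H0].
  by left; apply/eqP; rewrite eqn_leq TB.
have boxP rho : box rho -> rho \in P.
  move=> box_rho; apply/negPn/negP => /(heap_dominates inv box_rho)[e].
  by rewrite H0.
have [NB|/ltnW BN] := leqP N B.
  by right=> rho; move: (boxP rho); rewrite K_min (minn_idPr NB).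
left; apply/eqP; rewrite eqn_leq TB (card_state invst) /=.
have KB : K = B by rewrite K_min; exact/minn_idPl.
have : (size [seq [:: k] | k <- iota 1 K] <= size P)%N.
  apply: uniq_leq_size; first by rewrite map_inj_uniq ?iota_uniq // => k l [].
  move=> w /mapP[k]; rewrite mem_iota add1n ltnS => kK ->; apply: boxP.
  by rewrite /rank_box /= L_gt0 kK.
by rewrite size_map size_iota KB.
Qed.

End Search.

(** * Scores as logarithms of weights, and token rankings *)

Lemma prefix_weight_rank (R : realType) (V : finType) (q : nat -> V -> R)
    (tok : nat -> nat -> V) (rho : seq nat) :
  prefix_weight q (rank_prefix tok rho)
  = \prod_(0 <= j < size rho) q j.+1 (tok j.+1 (nth 0%N rho j)).
Proof.
rewrite -[in RHS](size_rank_prefix tok rho) big_mkord; apply: eq_bigr => i _.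
by rewrite (tnth_nth (tok 0 0)) nth_mkseq // -(size_rank_prefix tok).
Qed.

Lemma prefix_weight_gt0 (R : realType) (V : finType) (q : nat -> V -> R) (L : nat) u :
    (forall i x, (1 <= i <= L)%N -> 0 < q i x) -> (size u <= L)%N ->
  0 < prefix_weight q u.
Proof.
by move=> q0 uL; apply: prodr_gt0 => i _; rewrite q0 // (leq_trans (ltn_ord i)).
Qed.

Lemma score_prefix_weight (R : realType) (V : finType) (q : nat -> V -> R) (L : nat)
    (tok : nat -> nat -> V) (rho : seq nat) :
    (forall i x, (1 <= i <= L)%N -> 0 < q i x) -> (size rho <= L)%N ->
  score (fun i k => q i (tok i k)) rho = ln (prefix_weight q (rank_prefix tok rho)).
Proof.
move=> q0; rewrite prefix_weight_rank; elim/last_ind: rho => [|rho r IHrho].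
  by rewrite /score !big_geq // ln1.
rewrite score_rcons size_rcons => rL; rewrite IHrho 1?ltnW //.
have prefix_eq : \prod_(0 <= j < size rho) q j.+1 (tok j.+1 (nth 0 (rcons rho r) j)%N)
    = \prod_(0 <= j < size rho) q j.+1 (tok j.+1 (nth 0 rho j)%N).
  by rewrite !big_nat; apply: eq_bigr => j /andP[_ jr]; rewrite nth_rcons jr.
rewrite big_nat_recr //= prefix_eq nth_rcons ltnn eqxx.
rewrite lnM ?posrE //; last by apply: q0.
rewrite big_mkord.
apply: prodr_gt0 => i _.
by apply: q0; rewrite (leq_trans (ltn_ord i)) // ltnW.
Qed.

Section TokenRanking.
Variables (V : finType) (R : realType) (p : V -> R) (v : nat -> V).
Hypothesis v_ranking : token_ranking p v.

Lemma token_ranking_inj k l : (1 <= k <= #|V|)%N -> (1 <= l <= #|V|)%N ->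
  v k = v l -> k = l.
Proof.
have [perm_v _] := v_ranking.
have uniq_v : uniq [seq v k | k <- iota 1 #|V|] by rewrite (perm_uniq perm_v) enum_uniq.
(* Rank [m] sits at index [m.-1]; [v 0] is only a default value. *)
have nthE m : (1 <= m <= #|V|)%N ->
    (m.-1 < #|V|)%N /\ nth (v 0) [seq v k | k <- iota 1 #|V|] m.-1 = v m.
  case: m => // m /andP[_ mV]; split=> //.
  by rewrite (nth_map 0%N) ?size_iota // nth_iota.
move=> /[dup]/nthE[kV <-] /andP[k0 _] /[dup]/nthE[lV <-] /andP[l0 _].
move/(uniqP (v 0)): uniq_v => /[apply]; rewrite !inE size_map size_iota.
by move=> /(_ kV lV) kl; rewrite -(prednK k0) kl prednK.
Qed.

Lemma token_ranking_surj x : exists2 k, (1 <= k <= #|V|)%N & x = v k.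
Proof.
have [perm_v _] := v_ranking.
have : x \in [seq v k | k <- iota 1 #|V|] by rewrite (perm_mem perm_v) mem_enum.
by case/mapP => k; rewrite mem_iota add1n ltnS; exists k.
Qed.

End TokenRanking.

Lemma rank_prefix_surj (V : finType) (L : nat) (tok : nat -> nat -> V) (u : seq V) :
    (forall i x, (1 <= i <= L)%N -> exists2 k, (1 <= k <= #|V|)%N & x = tok i k) ->
    (1 <= size u <= L)%N ->
  exists2 rho, rank_box L #|V| rho & u = rank_prefix tok rho.
Proof.
move=> surj uL; case: u uL => // x0 u0; set u := x0 :: u0 => uL.
(* Finite choice of one rank per position of [u]. *)
have /fin_all_exists2[r rV ru] (j : 'I_(size u)) :
    exists2 k, (1 <= k <= #|V|)%N & nth x0 u j = tok j.+1 k.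
  by apply: surj; case/andP: uL => _; exact: leq_trans.
have szr : size [seq r j | j <- enum 'I_(size u)] = size u by rewrite size_map size_enum_ord.
exists [seq r j | j <- enum 'I_(size u)].
  by rewrite /rank_box szr uL; apply/allP => _ /mapP[j _ ->].
apply: (@eq_from_nth _ x0) => [|j ju]; first by rewrite size_rank_prefix szr.
rewrite nth_mkseq ?szr // (ru (Ordinal ju)) (nth_map (Ordinal ju)) ?size_enum_ord //.
by rewrite (nth_ord_enum _ (Ordinal ju)).
Qed.

(** * Optimality of the returned tree *)

Theorem proposition3 (R : realType) (V : finType) (L : nat) (hL : (1 <= L)%N)
    (q : nat -> V -> R)
    (hq01 : forall i x, (1 <= i <= L)%N -> 0 < q i x < 1)
    (hq1 : forall i, (1 <= i <= L)%N -> \sum_(x : V) q i x = 1)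
    (B : nat) (hB : (1 <= B)%N)
    (hBlt : (B < \sum_(1 <= d < L.+1) #|V| ^ d)%N)
    (K : nat) (hK : K = minn B #|V|)
    (v : nat -> nat -> V)
    (hv : forall i, (1 <= i <= L)%N -> token_ranking (q i) (v i)) :
  let prob := fun i k => q i (v i k) in
  [/\ bfs_terminates L K v prob B,
      exists T : {fset seq V}, bfs_returns L K v prob B T
    & forall T : {fset seq V}, bfs_returns L K v prob B T ->
        [/\ valid_draft_tree L T,
            (#|` T | <= B)%N
          & forall T' : {fset seq V},
              valid_draft_tree L T' -> (#|` T' | <= B)%N ->
              expected_acceptance L q T' <= expected_acceptance L q T]].
Proof.
move=> prob.
have q0 i x : (1 <= i <= L)%N -> 0 < q i x by move=> /(hq01 i x)/andP[].
have V_gt0 : (0 < #|V|)%N.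
  rewrite lt0n; apply/eqP => V0; have := hq1 1%N hL.
  rewrite big_pred0 => [/esym/eqP|x]; first by rewrite oner_eq0.
  by have := card0_eq V0 x; rewrite !inE.
have K_gt0 : (0 < K)%N by rewrite hK leq_min hB.
have leKV : (K <= #|V|)%N by rewrite hK geq_minr.
have tok_inj i k l : (1 <= i <= L)%N -> (1 <= k <= K)%N -> (1 <= l <= K)%N ->
    v i k = v i l -> k = l.
  move=> iL /andP[k0 kK] /andP[l0 lK]; apply: (token_ranking_inj (hv _ iL)).
    by rewrite k0 (leq_trans kK).
  by rewrite l0 (leq_trans lK).
have ln_le0 i k : (1 <= i <= L)%N -> (1 <= k <= K)%N -> ln (prob i k) <= 0.
  by move=> iL _; rewrite ln_le0 // ltW //; case/andP: (hq01 i (v i k) iL).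
have ln_noninc i k l : (1 <= i <= L)%N -> (1 <= k)%N -> (k <= l <= #|V|)%N ->
    ln (prob i l) <= ln (prob i k).
  move=> iL k0 /andP[kl lV]; rewrite ler_ln ?posrE ?q0 //.
  by have [_] := hv _ iL; apply.
have [term ret] := bfs_terminates_returns hL K_gt0 hK tok_inj ln_le0 ln_noninc.
split=> // T [H [reach stopped]].
have [P invst] := reachable_state_invariant hL K_gt0 hK tok_inj ln_le0 ln_noninc reach.
have [/= inv T_def TB] := invst.
have vT : valid_draft_tree L T by rewrite T_def; exact: rank_prefix_valid inv.
split=> // T' vT' T'B.
rewrite !(expected_acceptance_weight hq1) //.
have w0 u : (size u <= L)%N -> 0 < prefix_weight q u by exact: prefix_weight_gt0 q0.
have rankP u : (1 <= size u <= L)%N ->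
    exists2 rho, rank_box L #|V| rho & u = rank_prefix v rho.
  by apply: rank_prefix_surj => i x /hv/token_ranking_surj.
have w_scoreE rho : rank_box L #|V| rho ->
    score prob rho = ln (prefix_weight q (rank_prefix v rho)).
  by case/andP => /andP[_ rhoL] _; exact: score_prefix_weight q0 rhoL.
have in_T rho : rho \in P -> rank_prefix v rho \in T.
  by move=> rhoP; rewrite T_def; apply/imfsetP; exists rho.
have [TBeq|box_popped] := final_state hL hK tok_inj ln_le0 ln_noninc invst stopped.
  apply: ler_sum_fset_dominated => [|u /vT.1/andP[_ /w0/ltW]//|u t uT' uT tT].
    by rewrite TBeq.
  have [rho box_rho u_def] := rankP _ (vT'.1 _ uT').
  have /imfsetP[/= tau tauP t_def] : t \in [fset rank_prefix v rho | rho in P].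
    by rewrite -T_def.
  have box_tau : rank_box L #|V| tau.
    have /andP[tauL /allP tK] := popped_box inv tauP.
    by rewrite /rank_box tauL; apply/allP => r /tK/andP[-> /leq_trans->].
  have [[/andP[_ uL] /andP[_ tL]]] := (vT'.1 _ uT', vT.1 _ tT).
  (* Weights are positive, so they compare as their logarithms, the scores. *)
  rewrite -ler_ln ?posrE ?w0 // u_def t_def -!w_scoreE //.
  apply: (unpopped_score_le K_gt0 hK tok_inj ln_le0 ln_noninc invst) => //.
  by apply: contraNN uT; rewrite u_def; exact: in_T.
(* With every rank tuple popped, [T] contains all prefixes, hence every competitor. *)
have subT u : u \in T' -> u \in T.
  by move=> /vT'.1/rankP[rho /box_popped rhoP ->]; exact: in_T.
apply: ler_sum_fset_dominated => [|u /vT.1/andP[_ /w0/ltW]//|u t /subT -> //].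
exact: uniq_leq_size (fset_uniq _) subT.
Qed.
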